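(* Let $\Bbbk$ be a field, let $\Delta$ be a simplicial complex on $[n]$ with $\dim \Delta\geq1$, let $S=\Bbbk[x_1,\dots,x_n]$ with $\mathfrak m=(x_1,\dots,x_n)$, and let $\ell\geq2$. Then the following conditions are equivalent: (1) $H_{\mathfrak{m}}^{1}(S/I_{\Delta}^{(\ell)})=0$; (2) for any facets $F_{0}, G_{0}\in\mathcal{F}(\Delta)$ with $F_{0}\cap G_{0}=\emptyset$ and any $\mathbf a=(a_{1},\ldots, a_{n})\in\mathbb{N}^{n}$ such that $\sum_{i\in[n]}a_{i}\geq\ell$, $\sum_{i\notin F_{0}}a_{i}=\ell-1$ and $\sum_{i\notin G_{0}}a_{i}=\ell-1$, there exist facets $F, G\in\mathcal{F}(\Delta_{\mathbf a}(I_{\Delta}^{(\ell)}))$ such that $F\cap F_{0}\neq\emptyset$, $G\cap G_{0}\neq\emptyset$ and $F\cap G\neq\emptyset$.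
   Context: A simplicial complex $\Delta$ on $[n]$ is a nonempty collection of subsets of $[n]$ closed under taking subsets; $\mathcal F(\Delta)$ is its set of facets. $\mathbb N$ denotes the non-negative integers. $I_\Delta\subset S$ is generated by the squarefree monomials corresponding to (minimal) non-faces of $\Delta$. For a squarefree monomial ideal $I$, the $\ell$-th symbolic power is $I^{(\ell)}=\bigcap_{P\in\mathrm{Ass}(I)}P^\ell$. For a monomial ideal $I\subset S$ and $\mathbf a\in\mathbb N^n$, let $x^{\mathbf a}=x_1^{a_1}\cdots x_n^{a_n}$ and, for $F\subset[n]$, $S_F=S[x_j^{-1} : j\in F]$. The simplicial complex $\Delta_{\mathbf a}(I)$ is $\{F\subset[n] : x^{\mathbf a}\notin IS_F\}$. (For $I=I_\Delta^{(\ell)}$ it is known that the facets of $\Delta_{\mathbf a}(I_\Delta^{(\ell)})$ are exactly the facets $F$ of $\Delta$ with $\sum_{i\notin F}a_i\le \ell-1$.) *)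

(* Defs.v *)
From HB Require Import structures.
From mathcomp Require Import all_boot all_order all_algebra.
From mathcomp Require Import generic_quotient ring_quotient fraction.
From mathcomp Require Import boolp mpoly.

Set Implicit Arguments.
Unset Strict Implicit.
Unset Printing Implicit Defensive.

Import GRing.Theory.
Local Open Scope ring_scope.
Local Open Scope quotient_scope.

(* Ideals and submodules are boolean predicates; [boolp] makes any such
   predicate available classically. *)

Section Ideals.
Variable R : comNzRingType.
Implicit Types (A : R -> Prop) (I P : {pred R}) (l : nat).

Definition ideal_gen A : {pred R} := fun f =>
  `[< exists s : seq (R * R),
        (forall c, c \in s -> A c.2) /\ f = \sum_(c <- s) c.1 * c.2 >].

Definition ideal_pow P l : {pred R} :=
  ideal_gen (fun f => exists g : 'I_l -> R,
    (forall i, g i \in P) /\ f = \prod_(i < l) g i).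

(* [P] belongs to Ass(R/I); [idealr_closed] includes properness. *)
Definition assoc_prime I P : Prop :=
  [/\ idealr_closed P, prime_idealr_closed P &
      exists f : R, forall g : R, (g \in P) = (g * f \in I)].

Definition symbolic_power I l : {pred R^o} := fun f =>
  `[< forall P, assoc_prime I P -> f \in ideal_pow P l >].

Lemma ideal_gen0 A : 0 \in ideal_gen A.
Proof. by apply/asboolP; exists [::]; rewrite big_nil. Qed.

Lemma ideal_genMD A a f g :
  f \in ideal_gen A -> g \in ideal_gen A -> a * f + g \in ideal_gen A.
Proof.
move=> /asboolP[s [As ->]] /asboolP[t [At ->]]; apply/asboolP.
exists ([seq (a * c.1, c.2) | c <- s] ++ t); split.
  by move=> c; rewrite mem_cat => /orP[/mapP[d /As Ad ->]|/At].
rewrite big_cat big_map mulr_sumr; congr (_ + _).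
by apply: eq_bigr => c _; rewrite mulrA.
Qed.

Lemma symbolic_power_submod I l : submod_closed (symbolic_power I l).
Proof.
split=> [|a f g]; first by apply/asboolP => P _; exact: ideal_gen0.
move=> /asboolP If /asboolP Ig; apply/asboolP => P PI.
by apply: ideal_genMD; [exact: If|exact: Ig].
Qed.

HB.instance Definition _ I l :=
  GRing.isSubmodClosed.Build R R^o (symbolic_power I l)
    (symbolic_power_submod I l).

End Ideals.

Section QuotientModule.
Variables (R : nzRingType) (V : lmodType R) (U : submodClosed V).

Lemma submod_oppr_closed : oppr_closed U.
Proof. by move=> u Uu; rewrite -scaleN1r rpredZ. Qed.

(* [submodClosed] does not record closure under opposite. *)
Definition submod_zmod : zmodClosed V :=
  HB.pack (U : {pred V})
    (GRing.isOppClosed.Build V U submod_oppr_closed)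
    (GRing.isAddClosed.Build V U (rpred0D U)).

Definition quotmod := Quotient.quot submod_zmod.
HB.instance Definition _ := GRing.Zmodule.on quotmod.

Definition quotmod_scale (a : R) := lift_op1 quotmod ( *:%R a).

Lemma pi_quotmod_scale a :
  {morph \pi_quotmod : u / a *: u >-> quotmod_scale a u}.
Proof.
move=> u; unlock quotmod_scale; apply/eqP.
rewrite -(Quotient.idealrBE submod_zmod) -scalerBr rpredZ //.
by rewrite (Quotient.idealrBE submod_zmod) reprK.
Qed.

Let piD : {morph \pi_quotmod : u v / u + v} := Quotient.pi_add submod_zmod.

Lemma quotmod_scaleA a b v :
  quotmod_scale a (quotmod_scale b v) = quotmod_scale (a * b) v.
Proof. by rewrite -[v]reprK -!pi_quotmod_scale scalerA. Qed.

Lemma quotmod_scale1 : left_id 1 quotmod_scale.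
Proof. by move=> v; rewrite -[v]reprK -pi_quotmod_scale scale1r. Qed.

Lemma quotmod_scaleDr : right_distributive quotmod_scale +%R.
Proof.
move=> a u v; rewrite -[u]reprK -[v]reprK -piD -!pi_quotmod_scale.
by rewrite scalerDr piD.
Qed.

Lemma quotmod_scaleDl v : {morph quotmod_scale^~ v : a b / a + b}.
Proof.
by move=> a b; rewrite -[v]reprK -!pi_quotmod_scale scalerDl piD.
Qed.

HB.instance Definition _ := GRing.Zmodule_isLmodule.Build R quotmod
  quotmod_scaleA quotmod_scale1 quotmod_scaleDr quotmod_scaleDl.

End QuotientModule.

(* Local cohomology as the right derived functors of the torsion functor
   Gamma_J, computed from injective resolutions. *)

Section LocalCohomology.
Variable R : comNzRingType.

Definition injective_module (E : lmodType R) : Prop :=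
  forall (A B : lmodType R) (i : {linear A -> B}) (f : {linear A -> E}),
    injective i -> exists g : {linear B -> E}, forall a, g (i a) = f a.

Record injective_resolution (M : lmodType R) := InjectiveResolution {
  ires_obj : nat -> lmodType R;
  ires_aug : {linear M -> ires_obj 0};
  ires_diff : forall i, {linear ires_obj i -> ires_obj i.+1};
  _ : forall i, injective_module (ires_obj i);
  _ : injective ires_aug;
  _ : forall e, ires_diff 0 e = 0 <-> exists m, ires_aug m = e;
  _ : forall i e, ires_diff i.+1 e = 0 <-> exists e', ires_diff i e' = e
}.

Definition torsion (J : {pred R}) (E : lmodType R) (e : E) : Prop :=
  exists k : nat, forall p, p \in ideal_pow J k -> p *: e = 0.

(* The image of Gamma_J(E^(i-1)) in E^i, which is zero for i = 0. *)
Definition torsion_coboundary (J : {pred R}) (M : lmodType R)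
    (E : injective_resolution M) (i : nat) : ires_obj E i -> Prop :=
  match i return ires_obj E i -> Prop with
  | 0 => fun e => e = 0
  | j.+1 => fun e => exists e', torsion J e' /\ ires_diff E j e' = e
  end.

(* H^i_J(M) = 0.  The i-th cohomology of Gamma_J(E) does not depend, up to
   isomorphism, on the injective resolution E, and every module has one. *)
Definition local_cohomology_eq0 (J : {pred R}) (i : nat) (M : lmodType R) :
    Prop :=
  forall (E : injective_resolution M) (e : ires_obj E i),
    torsion J e -> ires_diff E i e = 0 -> torsion_coboundary J e.

End LocalCohomology.

Section SimplicialComplexes.
Variable n : nat.
Implicit Types (D : {set {set 'I_n}}) (F G : {set 'I_n}).

Definition simplicial_complex D : Prop :=
  D != set0 /\ forall F G, F \in D -> G \subset F -> G \in D.

Definition facets D : {set {set 'I_n}} :=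
  [set F | maxset (fun G => G \in D) F].

Definition sdim D : int := (\max_(F in D) #|F|)%N%:Z - 1.

End SimplicialComplexes.

Section MonomialIdeals.
Variables (k : fieldType) (n : nat).
Local Notation S := {mpoly k[n]}.
Implicit Types (D : {set {set 'I_n}}) (F : {set 'I_n}) (I : {pred S}).

Definition max_ideal : {pred S} := ideal_gen (fun f => exists i : 'I_n, f = 'X_i).

Definition stanley_reisner D : {pred S} :=
  ideal_gen (fun f => exists2 F, F \notin D & f = \prod_(i in F) 'X_i).

(* S_F = S[x_j^-1 : j in F] as a subring of the fraction field of S. *)
Definition localization F (u : {fraction S}) : Prop :=
  exists (p : S) (b : 'X_{1..n}),
    (forall j, j \notin F -> b j = 0%N) /\ u = tofrac p / tofrac 'X_[b].

(* The extended ideal I S_F. *)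
Definition extended_ideal I F (u : {fraction S}) : Prop :=
  exists s : seq ({fraction S} * S),
    (forall c, c \in s -> localization F c.1 /\ c.2 \in I) /\
    u = \sum_(c <- s) c.1 * tofrac c.2.

Definition degree_complex I (a : 'X_{1..n}) : {set {set 'I_n}} :=
  [set F | `[< ~ extended_ideal I F (tofrac 'X_[a]) >]].

End MonomialIdeals.

Arguments max_ideal k n : clear implicits.
Arguments stanley_reisner k {n} D.

(* Main.v *)
(* For M = S/J with J = I_D^(l), a class of H^1_m(M) amounts to a fraction
   "f_i / x_i^e" over every punctured chart, the charts agreeing modulo J.  As J
   is the monomial ideal of the x^a with sum_{i notin F} a_i >= l for every facet
   F, agreement is tested degree by degree: in degree a >= 0 it makes the
   coefficients constant along the facets of D_a(J), so the fractions glue to an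
   element of M as soon as D_a(J) is connected; in degrees with a negative entry
   they vanish because no facet is a single vertex.  Condition (2) yields both
   facts, after raising a on one vertex of each facet until both weights are l-1.
   Conversely, a failure of (2) at a produces, after rebalancing a, some b such
   that the facets of D_b(J) split into those inside a vertex set V and those
   outside it; the operator keeping x^b on V and 0 off V is then a nonzero class,
   read in the explicit injective resolution by the modules Hom_k(S, -). *)

Require Import Defs.
From mathcomp Require Import all_boot all_order all_algebra mpoly.
From HB Require Import structures.
From mathcomp Require Import generic_quotient ring_quotient fraction.
From mathcomp Require Import boolp zify.
From mathcomp Require classical_sets.

Set Implicit Arguments.
Unset Strict Implicit.
Unset Printing Implicit Defensive.

Import GRing.Theory.
Local Open Scope ring_scope.
Local Open Scope quotient_scope.

(** * Injective resolutions by coinduced modules *)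

Section QuotientMap.
Variables (R : nzRingType) (V : lmodType R) (U : submodClosed V).

Definition quotmap (v : V) : quotmod U := \pi_(quotmod U) v.

Lemma quotmap_linear : linear quotmap.
Proof.
move=> a u v; rewrite /quotmap.
by rewrite (Quotient.pi_add (submod_zmod U)) (pi_quotmod_scale U).
Qed.

HB.instance Definition _ :=
  GRing.isLinear.Build R V (quotmod U) _ quotmap quotmap_linear.

Lemma quotmap_eq0 v : (quotmap v == 0) = (v \in U).
Proof.
have -> : 0 = quotmap 0 by rewrite raddf0.
by rewrite /quotmap -(Quotient.idealrBE (submod_zmod U)) subr0.
Qed.

Lemma quotmap_eq u v : (quotmap u == quotmap v) = (u - v \in U).
Proof. by rewrite -subr_eq0 -raddfB quotmap_eq0. Qed.

Lemma quotmap_surj (x : quotmod U) : exists v, quotmap v = x.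
Proof. by exists (repr x); rewrite /quotmap reprK. Qed.

End QuotientMap.

Section Coinduced.
Variables (k : fieldType) (R : comNzRingType) (phi : {rmorphism k -> R}).

(* The k-action on an R-module is the one through phi, so that no second module
   structure is put on the same type. *)
Definition klinear (A V : lmodType R) (f : A -> V) : Prop :=
  forall c x y, f (phi c *: x + y) = phi c *: f x + f y.

Section Extension.
Variables (A B V : lmodType R) (i : {linear A -> B}) (f : A -> V).
Hypotheses (inj_i : injective i) (lin_f : klinear f).

(** Partial [k]-linear maps extending [f] along [i], kept as relations for Zorn's lemma; closure
    under combinations reduces single-valuedness to the value at 0. *)
Definition linear_graph (G : B -> V -> Prop) : Prop :=
  [/\ forall c x u y v, G x u -> G y v -> G (phi c *: x + y) (phi c *: u + v),
      forall v, G 0 v -> v = 0 & forall a, G (i a) (f a)].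

Lemma linear_graph_functional G x u v :
  linear_graph G -> G x u -> G x v -> u = v.
Proof.
case=> GD G0 _ Gu Gv; apply/eqP; rewrite -subr_eq0; apply/eqP/G0.
have := GD (-1) _ _ _ _ Gv Gu.
by rewrite rmorphN1 !scaleN1r addNr addrC.
Qed.

Lemma klinear0 : f 0 = 0.
Proof.
have := lin_f 1 0 0; rewrite rmorph1 !scale1r !addr0 => e.
by apply: (@addrI _ (f 0)); rewrite addr0 -e.
Qed.

Lemma image_linear_graph :
  linear_graph (fun b v => exists2 a, b = i a & v = f a).
Proof.
split=> [c x u y v [a -> ->] [a' -> ->]|v [a e ->]|a]; last by exists a.
  by exists (phi c *: a + a'); rewrite ?linearP ?lin_f.
by rewrite (inj_i (_ : i a = i 0)) ?klinear0 // -e raddf0.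
Qed.

(** The line through [b] joins the domain, with [b] sent to 0. *)
Definition adjoin_graph (G : B -> V -> Prop) b : B -> V -> Prop :=
  fun x u => exists c y, G y u /\ x = phi c *: b + y.

Lemma linear_graph_adjoin G b :
  linear_graph G -> (forall v, ~ G b v) -> linear_graph (adjoin_graph G b).
Proof.
move=> linG nGb; have [GD G0 Gi] := linG.
have G00 : G 0 0 by rewrite -(raddf0 i) -klinear0; exact: Gi.
split=> [c x u y v [c1 [x1 [Gx ->]]] [c2 [y1 [Gy ->]]]|v [c [y [Gy]]]|a].
- exists (c * c1 + c2), (phi c *: x1 + y1); split; first exact: GD.
  by rewrite rmorphD rmorphM scalerDl -scalerA scalerDr addrACA.
(* With [c] nonzero, [c b + y = 0] would give [b = - c^-1 y], already in the domain. *)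
- have [->|c_neq0] := eqVneq c 0.
    by rewrite rmorph0 scale0r add0r => y0; apply: G0; rewrite y0.
  move=> e; case: (nGb (phi (- c^-1) *: v)).
  have -> : b = phi (- c^-1) *: y.
    have -> : y = - (phi c *: b).
      by apply/eqP; rewrite -addr_eq0 addrC -e.
    by rewrite rmorphN scaleNr scalerN opprK scalerA -rmorphM mulVf // rmorph1
               scale1r.
  by have := GD (- c^-1) _ _ _ _ Gy G00; rewrite !addr0.
- by exists 0, (i a); rewrite rmorph0 scale0r add0r.
Qed.

(** Zorn's lemma on graphs ordered by inclusion: a maximal one is total, since a missing vector
    could be adjoined. *)
Lemma klinear_extension :
  exists g : B -> V, klinear g /\ forall a, g (i a) = f a.
Proof.
pose T := {G : B -> V -> Prop | `[< linear_graph G >]}.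
pose mk G (linG : linear_graph G) : T := exist _ G (asboolT linG).
pose le (G H : T) := `[< forall b v, val G b v -> val H b v >].
have [||C totC|[G linG0] maxG] :=
    @classical_sets.ZL_preorder T (mk _ image_linear_graph) le.
- by move=> G; apply/asboolP.
- by move=> G H K /asboolP GH /asboolP HK; apply/asboolP => b v /GH /HK.
(* The empty chain is bounded by the graph of [f]; its union would be the empty relation, which does
   not extend [f]. *)
- have [[G0 CG0]|nC] := pselect (exists G, C G); last first.
    exists (mk _ image_linear_graph) => G CG.
    by case: nC; exists G.
  pose U b v := exists2 G : T, C G & val G b v.
  have linU : linear_graph U.
    split=> [c x u y v [G CG Gx] [H CH Hy]|v [[G /= /asboolP[_ + _]] _]|a].
    + have [/asboolP GH|/asboolP HG] := totC _ _ CG CH.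
        exists H => //; have /asboolP[HD _ _] := valP H.
        exact: HD (GH _ _ Gx) Hy.
      exists G => //; have /asboolP[GD _ _] := valP G.
      exact: GD Gx (HG _ _ Hy).
    + exact.
    + by exists G0 => //; have /asboolP[_ _] := valP G0.
  by exists (mk U linU) => G CG; apply/asboolP => b v; exists G.
have linG := asboolW linG0; have [GD G0 Gi] := linG.
have dom b : exists v, G b v.
  apply: contrapT => /forallNP nGb.
  have linH := linear_graph_adjoin linG nGb.
  have GH : le (exist _ G linG0) (mk _ linH).
    apply/asboolP => x u /= Gx; exists 0, x; split=> //.
    by rewrite rmorph0 scale0r add0r.
  have /asboolP/= HG := maxG (mk _ linH) GH.
  apply: (nGb 0); apply: HG; exists 1, 0; split.
    by rewrite -(raddf0 i) -klinear0; exact: Gi.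
  by rewrite rmorph1 scale1r addr0.
have [g Gg] := choice dom.
exists g; split=> [c x y|a]; apply: (linear_graph_functional linG (Gg _)) => //.
exact: GD.
Qed.

End Extension.

Variable V : lmodType R.

(* Hom_k(R, V), with r acting by precomposition with multiplication by r; maps
   of R-modules into it are k-linear maps into V. *)
Record coinduced := Coinduced {
  coind_fun : R -> V;
  coind_klinear : `[< klinear (coind_fun : R^o -> V) >] }.

HB.instance Definition _ := [isSub for coind_fun].
HB.instance Definition _ := [Choice of coinduced by <:].

Implicit Types f g : coinduced.

Lemma coind_funP f c s t :
  coind_fun f (phi c * s + t) = phi c *: coind_fun f s + coind_fun f t.
Proof. by have /asboolP/(_ c s t) := coind_klinear f. Qed.

Lemma coind_fun0 f : coind_fun f 0 = 0.
Proof. by have /asboolP/klinear0 := coind_klinear f. Qed.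

Lemma coinduced_ext f g : coind_fun f =1 coind_fun g -> f = g.
Proof. by move=> fg; apply/val_inj/funext. Qed.

Definition mk_coinduced (f : R -> V) (lf : klinear (f : R^o -> V)) :=
  Coinduced (asboolT lf).

Lemma coind_zero_subproof : klinear ((fun=> 0) : R^o -> V).
Proof. by move=> c x y; rewrite scaler0 addr0. Qed.
Definition coind_zero := mk_coinduced coind_zero_subproof.

Lemma coind_opp_subproof f : klinear ((fun s => - coind_fun f s) : R^o -> V).
Proof. by move=> c x y; rewrite coind_funP opprD scalerN. Qed.
Definition coind_opp f := mk_coinduced (coind_opp_subproof f).

Lemma coind_add_subproof f g :
  klinear ((fun s => coind_fun f s + coind_fun g s) : R^o -> V).
Proof. by move=> c x y; rewrite !coind_funP scalerDr addrACA. Qed.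
Definition coind_add f g := mk_coinduced (coind_add_subproof f g).

Lemma coind_scale_subproof r f :
  klinear ((fun s => coind_fun f (r * s)) : R^o -> V).
Proof. by move=> c x y; rewrite mulrDr mulrCA coind_funP. Qed.
Definition coind_scale r f := mk_coinduced (coind_scale_subproof r f).

Fact coind_addA : associative coind_add.
Proof. by move=> f g h; apply: coinduced_ext => s /=; rewrite addrA. Qed.
Fact coind_addC : commutative coind_add.
Proof. by move=> f g; apply: coinduced_ext => s /=; rewrite addrC. Qed.
Fact coind_add0 : left_id coind_zero coind_add.
Proof. by move=> f; apply: coinduced_ext => s /=; rewrite add0r. Qed.
Fact coind_addN : left_inverse coind_zero coind_opp coind_add.
Proof. by move=> f; apply: coinduced_ext => s /=; rewrite addNr. Qed.

HB.instance Definition _ :=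
  GRing.isZmodule.Build coinduced coind_addA coind_addC coind_add0 coind_addN.

Fact coind_scaleA a b f : coind_scale a (coind_scale b f) = coind_scale (a * b) f.
Proof. by apply: coinduced_ext => s /=; rewrite mulrA (mulrC b). Qed.
Fact coind_scale1 : left_id 1 coind_scale.
Proof. by move=> f; apply: coinduced_ext => s /=; rewrite mul1r. Qed.
Fact coind_scaleDr : right_distributive coind_scale +%R.
Proof. by move=> a f g; apply: coinduced_ext. Qed.
Fact coind_scaleDl f : {morph coind_scale^~ f : a b / a + b}.
Proof.
move=> a b; apply: coinduced_ext => s /=.
by have := coind_funP f 1 (a * s) (b * s); rewrite rmorph1 mul1r scale1r -mulrDl.
Qed.

HB.instance Definition _ := GRing.Zmodule_isLmodule.Build R coinduced
  coind_scaleA coind_scale1 coind_scaleDr coind_scaleDl.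

Lemma coind_scaleE r f s : coind_fun (r *: f) s = coind_fun f (r * s).
Proof. by []. Qed.

Lemma coind_addE f g s : coind_fun (f + g) s = coind_fun f s + coind_fun g s.
Proof. by []. Qed.

(** Evaluation at 1 turns an [R]-linear map into [coinduced] into a [k]-linear map to [V]. This
    extends to some [g] because [k] is a field, and [b |-> (s |-> g (s b))] is the [R]-linear
    extension. *)
Lemma injective_coinduced : injective_module coinduced.
Proof.
move=> A B i f inj_i.
have lin_f1 : klinear (fun a => coind_fun (f a) 1).
  move=> c x y; rewrite linearP coind_addE coind_scaleE.
  by rewrite -[_ * 1]addr0 coind_funP coind_fun0 addr0.
have [g [lin_g gi]] := klinear_extension inj_i lin_f1.
have lin_gb b : klinear ((fun s => g (s *: b)) : R^o -> V).
  by move=> c x y; rewrite scalerDl -scalerA lin_g.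
have lin_G : linear (fun b => mk_coinduced (lin_gb b)).
  move=> a x y; apply: coinduced_ext => s; rewrite coind_addE coind_scaleE /=.
  rewrite scalerDr scalerA -(scale1r (_ *: x)) -(rmorph1 phi) lin_g.
  by rewrite rmorph1 scale1r mulrC.
pose Gm := GRing.isLinear.Build R B coinduced _ _ lin_G.
pose h : {linear B -> coinduced} := HB.pack (fun b => mk_coinduced (lin_gb b)) Gm.
exists h => a.
apply: coinduced_ext => s /=.
by rewrite -linearZ gi linearZ coind_scaleE mulr1.
Qed.

Lemma coind_unit_subproof v : klinear ((fun s => s *: v) : R^o -> V).
Proof. by move=> c x y; rewrite scalerDl scalerA. Qed.
Definition coind_unit v := mk_coinduced (coind_unit_subproof v).

Lemma coind_unit_linear : linear coind_unit.
Proof.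
move=> a u v; apply: coinduced_ext => s /=.
by rewrite scalerDr !scalerA mulrC.
Qed.

HB.instance Definition _ :=
  GRing.isLinear.Build R V coinduced _ coind_unit coind_unit_linear.

Lemma coind_unit_inj : injective coind_unit.
Proof.
by move=> u v /(congr1 (fun f => coind_fun f 1)) /=; rewrite !scale1r.
Qed.

End Coinduced.

Section ImageSubmodule.
Variables (R : nzRingType) (A B : lmodType R) (h : {linear A -> B}).

Definition linear_image : {pred B} := fun b => `[< exists a, h a = b >].

Lemma linear_image_submod_closed : submod_closed linear_image.
Proof.
split=> [|c _ _ /asboolP[x <-] /asboolP[y <-]]; apply/asboolP.
  by exists 0; rewrite raddf0.
by exists (c *: x + y); rewrite linearP.
Qed.

HB.instance Definition _ :=
  GRing.isSubmodClosed.Build R B linear_image linear_image_submod_closed.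

End ImageSubmodule.

Section Resolution.
Variables (k : fieldType) (R : comNzRingType) (phi : {rmorphism k -> R}).

Definition coind_embed (V : lmodType R) : {linear V -> coinduced phi V} :=
  coind_unit phi (V := V).

Definition coind_coker (V : lmodType R) : lmodType R :=
  quotmod (linear_image (coind_embed V)).

Definition coind_proj V : {linear coinduced phi V -> coind_coker V} :=
  quotmap (linear_image (coind_embed V)).

Lemma coind_proj_eq0 V e :
  coind_proj V e = 0 <-> exists v, coind_embed V v = e.
Proof.
split=> [/eqP|e_im]; first by rewrite quotmap_eq0 => /asboolP.
by apply/eqP; rewrite quotmap_eq0; apply/asboolP.
Qed.

Lemma coind_proj_surj V v : exists e, coind_proj V e = v.
Proof. exact: quotmap_surj. Qed.

Lemma coind_embed_eq0 V v : coind_embed V v = 0 <-> v = 0.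
Proof.
split=> [|->]; last exact: raddf0.
by rewrite -(raddf0 (coind_embed V)) => /coind_unit_inj.
Qed.

Variable M : lmodType R.

Definition cosyzygy (i : nat) : lmodType R := iter i coind_coker M.

(** Projection to the cokernel, then its embedding in the next coinduced module: surjectivity of the
    first and injectivity of the second give exactness. *)
Definition coind_diff i :
    {linear coinduced phi (cosyzygy i) -> coinduced phi (cosyzygy i.+1)} :=
  coind_embed (cosyzygy i.+1) \o coind_proj (cosyzygy i).

Lemma coind_diff_eq0 i e :
  coind_diff i e = 0 <-> exists v, coind_embed (cosyzygy i) v = e.
Proof. exact: iff_trans (coind_embed_eq0 _) (coind_proj_eq0 e). Qed.

Lemma coind_diffP i e :
  coind_diff i.+1 e = 0 <-> exists e', coind_diff i e' = e.
Proof.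
rewrite coind_diff_eq0; split=> [[v <-]|[e' <-]]; last by eexists.
by have [u <-] := coind_proj_surj v; exists u.
Qed.

Definition coind_resolution : injective_resolution M :=
  @InjectiveResolution R M (fun i => coinduced phi (cosyzygy i))
    (coind_embed M) coind_diff
    (fun i => @injective_coinduced k R phi (cosyzygy i))
    (@coind_unit_inj k R phi M) (@coind_diff_eq0 0) coind_diffP.

End Resolution.

(** * Monomial ideals *)

Section IdealGen.
Variable R : comNzRingType.
Implicit Types (A : R -> Prop) (P : {pred R}).

Lemma ideal_genM A r g : A g -> r * g \in ideal_gen A.
Proof.
move=> Ag; apply/asboolP; exists [:: (r, g)]; rewrite big_seq1.
by split=> // c; rewrite inE => /eqP ->.
Qed.

Lemma eq_ideal_gen A B : (forall f, A f <-> B f) -> ideal_gen A =i ideal_gen B.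
Proof.
move=> AB f; apply/asboolP/asboolP => -[s [As ->]]; exists s.
  by split=> // c /As /AB.
by split=> // c /As /AB.
Qed.

Lemma eq_ideal_pow P P' l : P =i P' -> ideal_pow P l =i ideal_pow P' l.
Proof.
move=> PP'; apply: eq_ideal_gen => f; split=> -[g [gP ->]]; exists g.
  by split=> // i; rewrite -PP'.
by split=> // i; rewrite PP'.
Qed.

End IdealGen.

Section MonomialIdeal.
Variables (k : fieldType) (n : nat).
Local Notation S := {mpoly k[n]}.
Local Notation mono := 'X_{1..n}.
Implicit Types (Q : mono -> bool) (f g : S) (m : mono) (F G : {set 'I_n}).

Definition monoideal Q : {pred S} := fun f => all Q (msupp f).

Lemma monoidealP Q f : reflect (forall m, f@_m != 0 -> Q m) (f \in monoideal Q).
Proof.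
apply: (iffP allP) => Qf m; last by rewrite mcoeff_msupp => /Qf.
by rewrite -mcoeff_msupp => /Qf.
Qed.

Lemma monoideal_coeff Q f m : f \in monoideal Q -> ~~ Q m -> f@_m = 0.
Proof. by move=> /monoidealP Qf; apply: contraNeq => /Qf. Qed.

Lemma monoidealX Q m : ('X_[m] \in monoideal Q) = Q m.
Proof. by rewrite /monoideal unfold_in msuppX /= andbT. Qed.

Definition upclosed Q := forall m m', Q m -> Q (m + m')%MM.

Lemma monoideal0 Q : 0 \in monoideal Q.
Proof. by apply/monoidealP => m; rewrite mcoeff0 eqxx. Qed.

Lemma monoidealD Q f g :
  f \in monoideal Q -> g \in monoideal Q -> f + g \in monoideal Q.
Proof.
move=> /monoidealP Qf /monoidealP Qg; apply/monoidealP => m.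
rewrite mcoeffD; have [/eqP fm0|/Qf //] := boolP (f@_m == 0).
by rewrite fm0 add0r => /Qg.
Qed.

Lemma monoideal_prod Q Q' Q'' f g :
  (forall m m', Q m -> Q' m' -> Q'' (m + m')%MM) ->
  f \in monoideal Q -> g \in monoideal Q' -> f * g \in monoideal Q''.
Proof.
move=> QQ' /allP Qf /allP Qg; apply/allP => m.
by move/msuppM_le/allpairsP => -[[m1 m2] /= [/Qf Q1 /Qg Q2 ->]]; exact: QQ'.
Qed.

Lemma monoidealMl Q r f :
  upclosed Q -> f \in monoideal Q -> r * f \in monoideal Q.
Proof.
move=> upQ; apply: (@monoideal_prod predT) => [m m' _ Qm'|].
  by rewrite addmC; exact: upQ.
by apply/monoidealP.
Qed.

(** The bridge from generators to tests on supports. Generators may be arbitrary polynomials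
    supported in [Q], provided each monomial of [Q] is a multiple of a monomial generator. *)
Lemma ideal_gen_monoideal (A : S -> Prop) Q :
  upclosed Q -> (forall g, A g -> g \in monoideal Q) ->
  (forall m, Q m -> exists2 m', (m' <= m)%MM & A 'X_[m']) ->
  ideal_gen A =i monoideal Q.
Proof.
move=> upQ AQ QA f; apply/idP/idP => [/asboolP[s [As ->]]|/allP Qf].
  rewrite big_seq; elim/big_ind: _ => [||c /As/AQ]; first exact: monoideal0.
    by move=> g h; exact: monoidealD.
  exact: monoidealMl.
rewrite [f]mpolyE big_seq; elim/big_ind: _ => [||m /Qf Qm].
- exact: ideal_gen0.
- by move=> g h Ag Ah; rewrite -[g]mul1r; exact: ideal_genMD.
- have [m' le_m'm Am'] := QA m Qm.
  by rewrite -(submK le_m'm) mpolyXD scalerAl; exact: ideal_genM.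
Qed.

(* The order of x^m at the prime (x_i : i notin F). *)
Definition wt (F : {set 'I_n}) m : nat := (\sum_(i < n | i \notin F) m i)%N.

Lemma wtD F m m' : wt F (m + m') = (wt F m + wt F m')%N.
Proof. by rewrite /wt -big_split; apply: eq_bigr => i _; rewrite mnmDE. Qed.

Lemma wtMn F m j : wt F (m *+ j) = (wt F m * j)%N.
Proof. by rewrite /wt big_distrl; apply: eq_bigr => i _; rewrite mulmnE. Qed.

Lemma wtU F i : wt F U_(i) = (i \notin F).
Proof.
rewrite /wt; under eq_bigr do rewrite mnm1E.
have [iF|iF] := boolP (i \in F).
  rewrite big1 // => j jF; apply/eqP; rewrite eqb0.
  by apply: contraNneq jF => <-.
rewrite (bigD1 i) //= eqxx big1 // => j /andP[_].
by rewrite eq_sym => /negPf ->.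
Qed.

Lemma wt_gt0P F m :
  reflect (exists2 i, i \notin F & (0 < m i)%N) (0 < wt F m)%N.
Proof.
rewrite /wt lt0n sum_nat_eq0 negb_forall.
apply: (iffP existsP) => [[i]|[i iF mi]]; last by exists i; rewrite iF -lt0n mi.
by rewrite negb_imply -lt0n => /andP[]; exists i.
Qed.

Lemma leq_wt F m i : i \notin F -> (m i <= wt F m)%N.
Proof. by move=> iF; rewrite /wt (bigD1 i) //= leq_addr. Qed.

Lemma wt_upclosed F l : upclosed (fun m => l <= wt F m)%N.
Proof. by move=> m m' /leq_trans; apply; rewrite wtD leq_addr. Qed.

Lemma wt_subset F G m : F \subset G -> (wt G m <= wt F m)%N.
Proof.
move=> FG; rewrite /wt [X in (_ <= X)%N]big_mkcond [X in (X <= _)%N]big_mkcond /=.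
apply: leq_sum => i _; have [//|iG] := boolP (i \in G).
by rewrite ifT //; apply: contraNN iG => /(subsetP FG).
Qed.

Definition wtideal F l := monoideal (fun m => l <= wt F m)%N.

Lemma wt_factor F l m : (l <= wt F m)%N ->
  exists g : 'I_l -> 'I_n,
    (forall j, g j \notin F) /\ (\sum_(j < l) U_(g j) <= m)%MM.
Proof.
elim: l m => [|l IHl] m lm.
  exists (fun j : 'I_0 => False_rect _ (notF (ltn_ord j))).
  by split=> [[]//|]; rewrite big_ord0; apply/mnm_lepP => i; rewrite mnm0E.
have /wt_gt0P[i iF mi] : (0 < wt F m)%N by apply: leq_ltn_trans lm.
have Uim : (U_(i) <= m)%MM by rewrite lep1mP -lt0n.
have [|g [gF gm]] := IHl (m - U_(i))%MM.
  by have := lm; rewrite -{1}(submK Uim) wtD wtU iF addn1.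
exists (fun j => if unlift ord0 j is Some j' then g j' else i); split=> [j|].
  by case: unliftP.
rewrite big_ord_recl unlift_none; under eq_bigr do rewrite liftK.
rewrite -(submK Uim) addmC; apply/mnm_lepP => j; rewrite !mnmDE leq_add2r.
by have /mnm_lepP := gm.
Qed.

(** Orders add up in a product of [l] members of the prime; conversely [wt_factor] splits [l]
    variables of the prime off a monomial. *)
Lemma ideal_pow_wtideal F l : ideal_pow (wtideal F 1) l =i wtideal F l.
Proof.
apply: ideal_gen_monoideal => [|_ [g [gP ->]]|m /wt_factor[g [gF gm]]].
- exact: wt_upclosed.
- elim: l g gP => [|l IHl] g gP.
    by rewrite big_ord0; apply/monoidealP.
  rewrite big_ord_recl; apply: monoideal_prod (gP ord0) (IHl _ _) => // m m'.
  by move=> m1 lm'; rewrite wtD; lia.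
- exists (\sum_(j < l) U_(g j))%MM => //; exists (fun j => 'X_(g j)).
  by split=> [j|]; rewrite ?mprodXE // monoidealX wtU gF.
Qed.

(* Evaluation with kernel the ideal (x_i : i notin F), which is therefore prime. *)
Definition kill_outside F : n.-tuple S := [tuple if i \in F then 'X_i else 0 | i < n].

Lemma mcoeff_kill_outside F f m :
  (f \mPo kill_outside F)@_m = if wt F m == 0%N then f@_m else 0.
Proof.
have killX m' : 'X_[m'] \mPo kill_outside F = (wt F m' == 0%N)%:R *: 'X_[m'].
  rewrite comp_mpolyX; have [w0|/negP] := eqVneq; last first.
    move/negP; rewrite -lt0n => /wt_gt0P[i iF mi].
    rewrite scale0r (bigD1 i) //= tnth_mktuple (negPf iF).
    by rewrite expr0n -leqn0 leqNgt mi mul0r.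
  rewrite scale1r [RHS]mpolyXE_id; apply: eq_bigr => i _; rewrite tnth_mktuple.
  have [//|iF] := boolP (i \in F).
  by have := leq_wt m' iF; rewrite w0 leqn0 => /eqP ->; rewrite !expr0.
rewrite comp_mpolyEX raddf_sum /= [in RHS](mpolyE f) raddf_sum /=.
rewrite (eq_bigr (fun m' => if wt F m == 0%N then (f@_m' *: 'X_[m'])@_m else 0)).
  by case: ifP => // _; rewrite big1.
move=> m' _; rewrite killX !mcoeffZ mcoeffX.
have [->|_] := eqVneq m' m; last by rewrite !mulr0 if_same.
by case: ifP; rewrite ?mul1r ?mul0r ?mulr0.
Qed.

Lemma wtideal1E F f : (f \in wtideal F 1) = (f \mPo kill_outside F == 0).
Proof.
apply/monoidealP/eqP => [Ff|e m].
  apply/mpolyP => m; rewrite mcoeff_kill_outside mcoeff0.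
  case: ifP => // w0; apply/eqP; apply: contraTT w0 => /Ff.
  by rewrite lt0n.
have /(congr1 (mcoeff m)) := e; rewrite mcoeff_kill_outside mcoeff0 lt0n.
by case: ifP => // _ ->; rewrite eqxx.
Qed.

Lemma wtideal1_prime F : prime_idealr_closed (wtideal F 1).
Proof. by move=> f g; rewrite !wtideal1E rmorphM /= mulf_eq0. Qed.

Lemma wtideal1_idealr F : idealr_closed (wtideal F 1).
Proof.
split=> [||a f g Ff Fg]; first exact: monoideal0.
  by rewrite -mpolyX0 monoidealX -leqNgt leqn0 /wt big1 // => i; rewrite mnm0E.
by apply: monoidealD Fg; apply: monoidealMl Ff; exact: wt_upclosed.
Qed.

Lemma max_ideal_wtideal : max_ideal k n =i wtideal set0 1.
Proof.
apply: ideal_gen_monoideal => [|_ [i ->]|m /wt_gt0P[i _ mi]].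
- exact: wt_upclosed.
- by rewrite monoidealX wtU inE.
- by exists U_(i)%MM; [rewrite lep1mP -lt0n|exists i].
Qed.

Lemma max_ideal_pow j : ideal_pow (max_ideal k n) j =i wtideal set0 j.
Proof.
by move=> f; rewrite (eq_ideal_pow _ max_ideal_wtideal) ideal_pow_wtideal.
Qed.

End MonomialIdeal.

(** * Symbolic powers of Stanley-Reisner ideals *)

Section StanleyReisner.
Variables (k : fieldType) (n : nat) (D : {set {set 'I_n}}).
Hypothesis hD : simplicial_complex D.
Local Notation S := {mpoly k[n]}.
Local Notation mono := 'X_{1..n}.
Implicit Types (f g : S) (m a : mono) (F G H : {set 'I_n}).

Definition mnm_supp m : {set 'I_n} := [set i | (0 < m i)%N].

Lemma facetsP F :
  reflect (F \in D /\ forall G, G \in D -> F \subset G -> G = F) (F \in facets D).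
Proof. by rewrite inE; apply: maxsetP. Qed.

Lemma facet_exists F : F \in D -> exists2 G, G \in facets D & F \subset G.
Proof.
move=> FD; have [G maxG FG] := maxset_exists (P := fun G => G \in D) FD.
by exists G => //; rewrite inE.
Qed.

Lemma facet_sub_eq F G : F \in facets D -> G \in facets D -> F \subset G -> F = G.
Proof. by move=> /facetsP[_ maxF] /facetsP[GD _] /maxF ->. Qed.

Lemma wt_supp F m : (wt F m == 0%N) = (mnm_supp m \subset F).
Proof.
rewrite -leqn0 leqNgt; apply/negP/subsetP => [w0 i|suppF /wt_gt0P[i iF mi]].
  by rewrite inE => mi; apply/negP => /negP iF; apply/w0/wt_gt0P; exists i.
by move: iF; rewrite suppF ?inE.
Qed.

(** A set is a non-face exactly when no facet contains it; on supports this writes the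
    Stanley-Reisner ideal as the intersection of the facet primes. *)
Lemma supp_notin_wt m :
  (mnm_supp m \notin D) = [forall F in facets D, (1 <= wt F m)%N].
Proof.
apply/idP/forall_inP => [nD F /facetsP[FD _]|wtD].
  rewrite lt0n wt_supp; apply: contraNN nD => suppF.
  by have [_ sub] := hD; exact: sub suppF.
apply/negP => /facet_exists[F /wtD]; rewrite lt0n wt_supp.
by move=> /negP.
Qed.

Lemma upclosed_supp : upclosed (fun m => mnm_supp m \notin D).
Proof.
move=> m m'; rewrite !supp_notin_wt => /forall_inP h; apply/forall_inP => F FD.
by rewrite wtD (leq_trans (h F FD)) ?leq_addr.
Qed.

Lemma supp_mesym1 F : mnm_supp (mesym1 F) = F.
Proof. by apply/setP => i; rewrite inE mnmE; case: (i \in F). Qed.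

Lemma mesym1_supp m : (mesym1 (mnm_supp m) <= m)%MM.
Proof. by apply/mnm_lepP => i; rewrite mnmE inE; case: (m i). Qed.

Lemma prod_var F : \prod_(i in F) 'X_i = 'X_[mesym1 F] :> S.
Proof.
rewrite mprodXE; congr 'X_[_]; apply/mnmP => i.
rewrite mnm_sumE mnmE; under eq_bigr do rewrite mnm1E.
have [iF|iF] := boolP (i \in F).
  by rewrite (bigD1 i) //= eqxx big1 ?addn0 // => j /andP[_ /negPf ->].
rewrite big1 // => j jF; apply/eqP; rewrite eqb0.
by apply: contraNneq iF => <-.
Qed.

Lemma stanley_reisnerE :
  stanley_reisner k D =i monoideal (fun m => mnm_supp m \notin D).
Proof.
apply: ideal_gen_monoideal => [|_ [F FD ->]|m mD].
- exact: upclosed_supp.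
- by rewrite prod_var monoidealX supp_mesym1.
- exists (mesym1 (mnm_supp m)); first exact: mesym1_supp.
  by exists (mnm_supp m); rewrite ?prod_var.
Qed.

Lemma stanley_reisnerP f :
  reflect (forall F, F \in facets D -> f \in wtideal F 1)
          (f \in stanley_reisner k D).
Proof.
rewrite stanley_reisnerE; apply: (iffP (monoidealP _ _)) => h.
  move=> F FD; apply/monoidealP => m /h; rewrite supp_notin_wt.
  by move=> /forall_inP; apply.
move=> m fm; rewrite supp_notin_wt; apply/forall_inP => F /h.
by move=> /monoidealP; apply.
Qed.

(** The witness is the product of the variables of [F]: it avoids the prime of [F] but lies in that
    of every other facet, as no other facet contains [F]. *)
Lemma facet_assoc_prime F :
  F \in facets D -> assoc_prime (stanley_reisner k D) (wtideal F 1).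
Proof.
move=> FD; split; [exact: wtideal1_idealr|exact: wtideal1_prime|].
exists 'X_[mesym1 F] => g; apply/idP/stanley_reisnerP => [Fg G GD|].
  have [->|neGF] := eqVneq G F.
    by rewrite mulrC; apply: monoidealMl Fg; exact: wt_upclosed.
  apply: monoidealMl; first exact: wt_upclosed.
  rewrite monoidealX lt0n wt_supp supp_mesym1; apply: contraNN neGF => FG.
  by rewrite (facet_sub_eq FD GD FG).
move=> /(_ F FD)/wtideal1_prime/orP[//|].
by rewrite monoidealX lt0n wt_supp supp_mesym1 subxx.
Qed.

(** Prime avoidance for [P = (I : f)]: if [P] contained no facet prime avoiding [f], an element
    outside [P] could be chosen in each of these, and their product would contradict primality. *)
Lemma assoc_prime_facet P :
  assoc_prime (stanley_reisner k D) P ->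
  exists2 F, F \in facets D & P =i wtideal F 1.
Proof.
move=> [[_ P1 idealP] primeP [f Pf]].
have [[F FD [nFf FP]]|noF] :=
    pselect (exists2 F, F \in facets D &
              f \notin wtideal F 1 /\ {subset wtideal F 1 <= P}).
  exists F => // g; apply/idP/idP => [|/FP //].
  rewrite Pf => /stanley_reisnerP/(_ F FD)/wtideal1_prime/orP[//|].
  by rewrite (negPf nFf).
have avoid F : exists g, F \in facets D -> f \notin wtideal F 1 ->
    g \in wtideal F 1 /\ g \notin P.
  have [/andP[FD nFf]|nF] := boolP ((F \in facets D) && (f \notin wtideal F 1)).
    apply: contrapT => /forallNP nog; apply: noF; exists F => //; split=> // g Fg.
    by apply/negPn/negP => nPg; apply: (nog g).
  by exists 0 => FD nFf; case/andP: nF.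
have [g gP] := choice avoid.
pose r := [seq F <- enum (facets D) | f \notin wtideal F 1].
have rP F : (F \in r) = (F \in facets D) && (f \notin wtideal F 1).
  by rewrite mem_filter mem_enum andbC.
(* The product times [f] lies in every facet prime, through [f] or through a factor [g F]. *)
have : \prod_(F <- r) g F \in P.
  rewrite Pf; apply/stanley_reisnerP => F FD.
  have [Ff|nFf] := boolP (f \in wtideal F 1).
    by apply: monoidealMl Ff; exact: wt_upclosed.
  have Fr : F \in r by rewrite rP FD.
  rewrite (big_rem F) //= -mulrA mulrC; apply: monoidealMl; first exact: wt_upclosed.
  by have [] := gP F FD nFf.
suff: forall s, {subset s <= r} -> \prod_(F <- s) g F \notin P.
  by move=> /(_ r) /(_ (fun _ => id))/negP.
(* The empty product is 1, excluded from [P] by properness. *)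
elim=> [|F s IHs] sub; first by rewrite big_nil.
rewrite big_cons; apply/negP => /primeP/orP[|].
  have := sub F; rewrite rP mem_head => /(_ isT)/andP[FD nFf].
  by have [_ /negP] := gP F FD nFf.
by apply/negP/IHs => G Gs; apply: sub; rewrite inE Gs orbT.
Qed.

Variable l : nat.
Local Notation J := (symbolic_power (stanley_reisner k D) l).

Definition in_symb m := [forall F in facets D, (l <= wt F m)%N].

Lemma in_symb_upclosed : upclosed in_symb.
Proof.
move=> m m' /forall_inP h; apply/forall_inP => F FD.
by rewrite wtD (leq_trans (h F FD)) ?leq_addr.
Qed.

(** The associated primes are exactly the facet primes, whose powers are cut out by weights. *)
Lemma symbolic_powerE : J =i monoideal in_symb.
Proof.
move=> f; apply/asboolP/monoidealP => [Jf m fm|Jf P].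
  apply/forall_inP => F FD.
  have := Jf _ (facet_assoc_prime FD); rewrite ideal_pow_wtideal.
  by move/monoidealP; apply.
move=> /assoc_prime_facet[F FD PF].
rewrite (eq_ideal_pow _ PF) ideal_pow_wtideal; apply/monoidealP => m /Jf.
by move=> /forall_inP; apply.
Qed.

Definition indicator_pow F j : mono := (mesym1 F *+ j)%MM.

(** Inverting the variables of [F] removes the weight conditions at facets not containing [F] and
    keeps the others. *)
Lemma degree_complexP a F :
  reflect (exists2 G, G \in facets D & F \subset G /\ (wt G a < l)%N)
          (F \in degree_complex J a).
Proof.
rewrite /degree_complex inE.
apply: (iffP (asboolP _)) => [nJ|[G GD [FG wtG]] [s [sP es]]].
  apply: contrapT => noG; apply: nJ.
  (* Facets containing [F] have weight at least [l] at [a]; any other misses a vertex of [F] and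
     gains at least [l] from the added power. *)
  have Jal : 'X_[a + indicator_pow F l] \in J.
    rewrite symbolic_powerE monoidealX; apply/forall_inP => G GD.
    rewrite wtD; have [FG|/subsetPn[i iF iG]] := boolP (F \subset G).
      rewrite leqNgt; apply/negP => wtG; apply: noG; exists G => //; split=> //.
      by apply: leq_trans wtG; rewrite ltnS leq_addr.
    apply: leq_trans (leq_addl _ _); apply: leq_trans (leq_wt _ iG).
    by rewrite mulmnE mnmE iF mul1n.
  exists [:: ((tofrac 'X_[indicator_pow F l])^-1, 'X_[a + indicator_pow F l])].
  rewrite big_seq1 /=; split=> [c|].
    rewrite inE => /eqP -> /=; split=> //.
    exists 1, (indicator_pow F l); rewrite rmorph1 mul1r; split=> // j jF.
    by rewrite mulmnE mnmE (negPf jF) mul0n.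
  rewrite mpolyXD rmorphM /= mulrC mulfK // tofrac_eq0.
  by rewrite -msupp_eq0 msuppX.
(* Denominators are cleared: they are monomials supported in [F], hence of weight 0 at [G]. *)
have {es} : exists (b : mono) (q : S), [/\ mnm_supp b \subset F, q \in J &
    tofrac 'X_[a] * tofrac 'X_[b] = tofrac q].
  rewrite es; elim: s sP {es} => [|[c1 c2] s IHs] sP.
    exists 0%MM, 0; rewrite big_nil mul0r rmorph0; split=> //.
      by apply/subsetP => i; rewrite inE mnm0E.
    exact: rpred0.
  have [|b [q [bF Jq eq]]] := IHs; first by move=> c cs; apply: sP; rewrite inE cs orbT.
  have [/= [p [b' [b'F ->]]] Jc2] := sP (c1, c2) (mem_head _ _).
  exists (b + b')%MM, (p * 'X_[b] * c2 + 'X_[b'] * q); split.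
  - apply/subsetP => i; rewrite inE mnmDE addn_gt0 => /orP[bi|b'i].
      by apply: (subsetP bF); rewrite inE.
    by apply: contraTT b'i => /b'F ->.
  - rewrite symbolic_powerE; apply: monoidealD; apply: monoidealMl => //;
      by rewrite -?symbolic_powerE //; exact: in_symb_upclosed.
  - rewrite big_cons /= mpolyXD rmorphM /= mulrDl rmorphD !rmorphM /= -eq.
    have nz : tofrac ('X_[b'] : S) != 0 by rewrite tofrac_eq0 -msupp_eq0 msuppX.
    congr (_ + _); last by rewrite mulrA mulrC.
    rewrite (mulrC (tofrac 'X_[b])) [LHS]mulrACA divfK //.
    by rewrite (mulrC (tofrac c2)) mulrA.
move=> [b [q [bF Jq]]]; rewrite -rmorphM => /eqP; rewrite tofrac_eq => /eqP e.
move: Jq; rewrite -e -mpolyXD symbolic_powerE monoidealX => /forall_inP/(_ G GD).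
rewrite wtD (eqP (_ : wt G b == 0%N)) ?wt_supp ?(subset_trans bF) //.
by rewrite addn0 leqNgt wtG.
Qed.

Lemma degree_complex_facets a F :
  (F \in facets (degree_complex J a)) = (F \in facets D) && (wt F a < l)%N.
Proof.
rewrite [LHS]inE; apply/maxsetP/andP => [[/degree_complexP[G GD [FG wtG]] maxF]|].
  by rewrite -(maxF G) //; apply/degree_complexP; exists G.
move=> [FD wtF]; split=> [|H /degree_complexP[G GD [HG _]] FH].
  by apply/degree_complexP; exists F.
by apply/eqP; rewrite eqEsubset FH andbT (facet_sub_eq FD GD) // (subset_trans FH).
Qed.

End StanleyReisner.

(** * Gluing along linked facets *)

Section Weights.
Variable n : nat.
Local Notation mono := 'X_{1..n}.
Implicit Types (m a : mono) (F G H : {set 'I_n}).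

Lemma wt_mdeg m : wt set0 m = mdeg m.
Proof. by rewrite mdegE; apply: eq_bigl => i; rewrite inE. Qed.

Lemma wt_compl F m : (wt F m + wt (~: F) m = mdeg m)%N.
Proof.
rewrite mdegE (bigID (mem F)) /= addnC; congr (_ + _)%N.
by apply: eq_bigl => i; rewrite inE negbK.
Qed.

Lemma wt_leq_mdeg F m : (wt F m <= mdeg m)%N.
Proof. by rewrite -(wt_compl F) leq_addr. Qed.

End Weights.

Section LargeFacets.
Variables (n : nat) (D : {set {set 'I_n}}).
Hypothesis hdim : 1 <= sdim D.

Lemma large_facet : exists2 H, H \in facets D & (1 < #|H|)%N.
Proof.
suff [H HD cardH] : exists2 H, H \in D & (1 < #|H|)%N.
  have [G GD HG] := facet_exists HD; exists G => //.
  exact: leq_trans (subset_leq_card HG).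
apply: contrapT => noH; move: hdim; rewrite /sdim.
suff : (\max_(F in D) #|F| <= 1)%N by lia.
apply/bigmax_leqP => F FD; rewrite leqNgt; apply/negP => cF; apply: noH.
by exists F.
Qed.

Lemma facet_neq0 F : F \in facets D -> F != set0.
Proof.
have [H HD cardH] := large_facet; move=> FD; apply: contraTneq cardH => F0.
by rewrite -(facet_sub_eq FD HD) F0 ?sub0set ?cards0.
Qed.

End LargeFacets.

Section Connectivity.
Variables (n : nat) (D : {set {set 'I_n}}) (l : nat).
Hypothesis hl : (2 <= l)%N.
Local Notation mono := 'X_{1..n}.
Implicit Types (m a : mono) (F G H : {set 'I_n}).

(** Condition (2) in terms of weights alone; [degree_complex_facets] gives the translation. *)
Definition facets_linked : Prop := forall F0 G0 a,
  F0 \in facets D -> G0 \in facets D -> F0 :&: G0 = set0 -> (l <= mdeg a)%N ->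
  wt F0 a = (l - 1)%N -> wt G0 a = (l - 1)%N ->
  exists F G, [/\ F \in facets D, G \in facets D, (wt F a < l)%N, (wt G a < l)%N &
    [/\ F :&: F0 != set0, G :&: G0 != set0 & F :&: G != set0]].

(** Linking is applied to [(x_i x_j)^(l-1)], whose degree [2 (l - 1)] is at least [l] because
    [l >= 2]. *)
Lemma link_ends i j F G :
  facets_linked -> F \in facets D -> G \in facets D -> F :&: G = set0 ->
  i \in F -> j \in G ->
  exists F' G', [/\ F' \in facets D, G' \in facets D &
    [/\ F' :&: F != set0, G' :&: G != set0 & F' :&: G' != set0]].
Proof.
move=> linked FD GD FG0 iF jG.
have nFG x : x \in F -> x \notin G.
  by move=> xF; apply/negP => xG; have := in_set0 x; rewrite -FG0 inE xF xG.
have jF : j \notin F by apply: contraTN jG => /nFG.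
have [|||F' [G' [F'D G'D _ _ link]]] :=
    linked F G ((U_(i) + U_(j)) *+ (l - 1))%MM FD GD FG0.
- by rewrite mdegMn mdegD !mdeg1; lia.
- by rewrite wtMn wtD !wtU iF jF mul1n.
- by rewrite wtMn wtD !wtU (nFG i iF) jG mul1n.
by exists F', G'.
Qed.

Lemma linked_constant (T : Type) (u : 'I_n -> T) a : facets_linked ->
  (forall F i j, F \in facets D -> (wt F a < l)%N -> i \in F -> j \in F -> u i = u j) ->
  forall F G i j, F \in facets D -> (wt F a < l)%N -> G \in facets D ->
    (wt G a < l)%N -> i \in F -> j \in G -> u i = u j.
Proof.
move=> linked const F0 G0 i j F0D wF0 G0D wG0 iF0 jG0.
have chain F G : F \in facets D -> G \in facets D ->
    (wt F a < l)%N -> (wt G a < l)%N -> F :&: F0 != set0 -> G :&: G0 != set0 ->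
    F :&: G != set0 -> u i = u j.
  move=> FD GD wF wG /set0Pn[x /setIP[xF xF0]] /set0Pn[y /setIP[yG yG0]].
  move=> /set0Pn[z /setIP[zF zG]].
  rewrite (const F0 i x) // (const F x z) // (const G z y) //.
  exact: (const G0).
have [FG0|/set0Pn[x /setIP[xF xG]]] := eqVneq (F0 :&: G0) set0; last first.
  by rewrite (const F0 i x) // (const G0 x j).
have nFG x : x \in F0 -> x \notin G0.
  by move=> xF; apply/negP => xG; have := in_set0 x; rewrite -FG0 inE xF xG.
have jF0 : j \notin F0 by apply: contraTN jG0 => /nFG.
(* Raising [a] at [i] affects the weight at [G0] only, and at [j] that at [F0] only, so both become
   [l - 1]. Facets of low weight at [a + b] also have low weight at [a]. *)
pose b := (U_(i) *+ (l - 1 - wt G0 a) + U_(j) *+ (l - 1 - wt F0 a))%MM.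
have [lab|abl] := leqP l (mdeg (a + b)%MM).
  have [||F [G [FD GD wF wG [FF0 GG0 FG]]]] := linked F0 G0 (a + b)%MM F0D G0D FG0 lab.
  - by rewrite /b !wtD !wtMn !wtU iF0 jF0 /=; lia.
  - by rewrite /b !wtD !wtMn !wtU (nFG i iF0) jG0 /=; lia.
  rewrite !wtD in wF wG.
  apply: (chain F G) => //; [move: wF|move: wG];
    by apply: leq_ltn_trans; rewrite leq_addr.
have [F [G [FD GD [FF0 GG0 FG]]]] := link_ends linked F0D G0D FG0 iF0 jG0.
(* Here the degree of [a] itself is below [l], so every facet has low weight and any link of [F0] to
   [G0] will do. *)
have wa H : (wt H a < l)%N.
  by apply: leq_ltn_trans (wt_leq_mdeg _ _) _; rewrite mdegD in abl; lia.
exact: (chain F G).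
Qed.

Hypothesis hdim : 1 <= sdim D.

(** A facet reduced to one vertex meets no other facet, so it could not be linked to a facet with at
    least two vertices. *)
Lemma facet_second_vertex F i : facets_linked -> F \in facets D -> i \in F ->
  exists2 j, j \in F & j != i.
Proof.
move=> linked FD iF; apply: contrapT => noj.
have {noj}F1 : F = [set i].
  apply/eqP; rewrite eqEsubset sub1set iF andbT; apply/subsetP => j jF.
  by rewrite inE; apply/negPn/negP => ji; apply: noj; exists j.
have meetF H : H \in facets D -> i \in H -> H = F.
  by move=> HD iH; rewrite -(facet_sub_eq FD HD) // F1 sub1set.
have meetF' H : H \in facets D -> H :&: F != set0 -> H = F.
  move=> HD /set0Pn[x /setIP[xH]]; rewrite {1}F1 inE => /eqP xi.
  by apply: meetF; rewrite // -xi.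
have [G GD cardG] := large_facet hdim.
have FG0 : F :&: G = set0.
  apply/eqP/negPn/negP; rewrite setIC => /(meetF' _ GD) GF.
  by move: cardG; rewrite GF F1 cards1.
have [j jG] := set0Pn _ (facet_neq0 hdim GD).
have [F' [G' [F'D G'D [F'F G'G F'G']]]] := link_ends linked FD GD FG0 iF jG.
move: F'G'; rewrite (meetF' _ F'D F'F) setIC => /(meetF' _ G'D) G'F.
by move: G'G; rewrite G'F FG0 eqxx.
Qed.

End Connectivity.

Section Gluing.
Variables (k : fieldType) (n : nat) (D : {set {set 'I_n}}) (l : nat).
Hypotheses (hD : simplicial_complex D) (hdim : 1 <= sdim D) (hl : (2 <= l)%N).
Hypothesis linked : facets_linked D l.
Local Notation S := {mpoly k[n]}.
Local Notation J := (symbolic_power (stanley_reisner k D) l).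
Local Notation mono := 'X_{1..n}.
Implicit Types (f g : S) (m a : mono) (F G : {set 'I_n}).

Lemma mcoeffXUM i j f m :
  ('X_[U_(i) *+ j] * f)@_m = if (j <= m i)%N then f@_(m - U_(i) *+ j) else 0.
Proof.
have Uj x : (U_(i) *+ j)%MM x = (if x == i then j else 0)%N.
  by rewrite mulmnE mnm1E eq_sym; case: eqP; rewrite ?mul1n ?mul0n.
rewrite mulrC; case: ifP => [jm|/negP jm].
  rewrite -{1}(@submK _ (U_(i) *+ j)%MM m); last first.
    by apply/mnm_lepP => x; rewrite Uj; case: eqP => // ->.
  by rewrite addmC mcoeffMX.
apply: memN_msupp_eq0; apply/negP; rewrite (perm_mem (msuppMX _ _)).
by move=> /mapP[m' _ me]; apply: jm; rewrite me mnmDE Uj eqxx leq_addr.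
Qed.

Lemma coeff_mod_symb F f g m : F \in facets D -> (wt F m < l)%N ->
  f - g \in J -> f@_m = g@_m.
Proof.
move=> FD wF; rewrite symbolic_powerE // => Jfg.
apply/eqP; rewrite -subr_eq0 -mcoeffB; apply/eqP/(monoideal_coeff Jfg).
by apply/negP => /forall_inP/(_ F FD); rewrite leqNgt wF.
Qed.

Variables (e : nat) (f : 'I_n -> S).
Hypothesis compat :
  forall i j, 'X_[U_(j) *+ e] * f i - 'X_[U_(i) *+ e] * f j \in J.

(* The coefficient of x^a in f_i / x_i^e. *)
Definition fiber_coeff a i := (f i)@_(a + U_(i) *+ e).

(** Both sides are coefficients of [x_j^e f_i] and [x_i^e f_j] at one monomial, whose weight at [F]
    is still that of [a]. *)
Lemma fiber_coeff_facet a F i j : F \in facets D -> (wt F a < l)%N ->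
  i \in F -> j \in F -> fiber_coeff a i = fiber_coeff a j.
Proof.
move=> FD wF iF jF; rewrite /fiber_coeff.
rewrite -(mcoeffMX (f i) (U_(j) *+ e)) -(mcoeffMX (f j) (U_(i) *+ e)).
have -> : (U_(i) *+ e + (a + U_(j) *+ e) = U_(j) *+ e + (a + U_(i) *+ e))%MM.
  by apply/mnmP => x; rewrite !mnmDE; lia.
rewrite ![f _ * _]mulrC; apply: (@coeff_mod_symb F) => //.
by rewrite !wtD !wtMn !wtU iF jF !mul0n !addn0.
Qed.

Definition in_degree_facet a (p : {set 'I_n} * 'I_n) :=
  [&& p.1 \in facets D, (wt p.1 a < l)%N & p.2 \in p.1].

(** Linking makes the value independent of the picked facet and vertex. The default 0 occurs when no
    nonempty facet has low weight. *)
Definition glued_coeff a :=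
  if [pick p | in_degree_facet a p] is Some p then fiber_coeff a p.2 else 0.

(** A coefficient glued at [a] is read from some [f i] in degree at least that of [a], so it
    vanishes from this bound on and the glued sum is finite. *)
Definition glue_bound := (\max_(i < n) msize (f i))%N.

Definition glued : S :=
  \sum_(m : 'X_{1..n < glue_bound}) (glued_coeff m *: 'X_[m]).

Lemma mcoeff_glued a : glued@_a = glued_coeff a.
Proof.
have [am|ma] := ltnP (mdeg a) glue_bound; first exact: mcoeff_mpoly.
have -> : glued_coeff a = 0.
  rewrite /glued_coeff; case: pickP => // p _.
  apply: memN_msupp_eq0; apply: msize_mdeg_ge.
  apply: leq_trans (leq_trans ma _); first exact: (leq_bigmax p.2).
  by rewrite mdegD leq_addr.
rewrite raddf_sum big1 //= => m _; rewrite mcoeffZ mcoeffX.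
have [ema|_] := eqVneq (m : mono) a; last by rewrite mulr0.
by move: (bmdeg m); rewrite ema ltnNge ma.
Qed.

Lemma glued_coeffE a F i : F \in facets D -> (wt F a < l)%N -> i \in F ->
  glued_coeff a = fiber_coeff a i.
Proof.
move=> FD wF iF; rewrite /glued_coeff; case: pickP => [[G j]|/(_ (F, i))].
  case/and3P=> /= GD wG jG.
  apply: (linked_constant (u := fiber_coeff a) hl linked _ GD wG FD wF jG iF).
  by move=> H x y HD wH xH yH; exact: fiber_coeff_facet wH xH yH.
by rewrite /in_degree_facet /= FD wF iF.
Qed.

(** The extra factor [x_i^l] handles facets without [i]: low weight there forces the exponent of
    [x_i] below [l], so both coefficients vanish. *)
Lemma gluedP i : 'X_[U_(i) *+ l] * f i - 'X_[U_(i) *+ (l + e)] * glued \in J.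
Proof.
rewrite symbolic_powerE //; apply/monoidealP => m; apply: contraR => nJm.
have /forall_inPn[F FD] := nJm; rewrite -ltnNge => wF.
rewrite mcoeffB !mcoeffXUM subr_eq0.
have [iF|iF] := boolP (i \in F); last first.
  have mil := leq_ltn_trans (leq_wt m iF) wF.
  by rewrite !ifF //; apply/negbTE; rewrite -ltnNge ?(leq_trans mil) ?leq_addr.
case: (leqP l) => [lm|ml]; last first.
  by rewrite ifF //; apply/negbTE; rewrite -ltnNge (leq_trans ml) ?leq_addr.
case: leqP => [lem|mle].
  set a := (m - U_(i) *+ (l + e))%MM.
  have ea : (m - U_(i) *+ l = a + U_(i) *+ e)%MM.
    apply/mnmP => j; rewrite /a mnmDE !mnmBE !mulmnE mnm1E.
    by case: eqP => [<-|_]; lia.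
  have wa : (wt F a < l)%N.
    apply: leq_ltn_trans wF; apply: leq_sum => j _.
    by rewrite mnmBE leq_subr.
  by rewrite mcoeff_glued (glued_coeffE FD wa iF) ea.
(* The fraction would have a negative exponent at [i]. Comparison with the chart of a second vertex
   [j] gives a coefficient of [x_i^e f_j] where [x_i] has exponent below [e], hence 0. *)
have [j jF ji] := facet_second_vertex hl hdim linked FD iF.
set a := (m - U_(i) *+ l)%MM.
have ai : (a i < e)%N by rewrite /a mnmBE mulmnE mnm1E eqxx mul1n; lia.
have wM : (wt F (U_(j) *+ e + a)%MM < l)%N.
  rewrite wtD wtMn wtU jF mul0n add0n.
  apply: leq_ltn_trans wF; apply: leq_sum => x _.
  by rewrite mnmBE leq_subr.
have := coeff_mod_symb FD wM (compat i j).
rewrite mulrC mcoeffMX => ->; rewrite mcoeffXUM mnmDE mulmnE mnm1E (negPf ji).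
by rewrite mul0n add0n leqNgt ai.
Qed.

End Gluing.

(** * Vanishing of the first local cohomology from linked facets *)

Section Vanishing.
Variables (k : fieldType) (n : nat) (D : {set {set 'I_n}}) (l : nat).
Hypotheses (hD : simplicial_complex D) (hdim : 1 <= sdim D) (hl : (2 <= l)%N).
Local Notation S := {mpoly k[n]}.
Local Notation J := (symbolic_power (stanley_reisner k D) l).

Lemma mdeg_large_coord (j : nat) (m : 'X_{1..n}) :
  (n * j < mdeg m)%N -> exists i, (j <= m i)%N.
Proof.
move=> mj; apply: contrapT => nm; move: mj; apply/negP; rewrite -leqNgt mdegE.
apply: leq_trans (_ : \sum_(i < n) j <= _)%N; last by rewrite sum_nat_const card_ord.
apply: leq_sum => i _; rewrite leqNgt; apply/negP => ji; apply: nm.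
by exists i; exact: ltnW.
Qed.

(** By pigeonhole, a monomial of degree above [n * j] is divisible by some [x_i^j]. *)
Lemma torsion_of_powers (E : lmodType S) (x : E) j :
  (forall i : 'I_n, 'X_[U_(i) *+ j] *: x = 0) -> torsion (max_ideal k n) x.
Proof.
move=> xj; exists (n * j).+1 => p; rewrite max_ideal_pow => /allP pj.
rewrite [p]mpolyE big_seq scaler_suml big1 // => m /pj; rewrite wt_mdeg.
move=> /mdeg_large_coord[i jmi].
have le : (U_(i) *+ j <= m)%MM.
  by apply/mnm_lepP => x'; rewrite mulmnE mnm1E; case: eqP => [<-|]; lia.
by rewrite -(submK le) mpolyXD scalerAl -scalerA xj scaler0.
Qed.

Lemma facets_linked_vanishing : facets_linked D l ->
  local_cohomology_eq0 (max_ideal k n) 1 (quotmod J).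
Proof.
move=> linked E e [j ej] de.
case: E e ej de => obj aug d inj inj_aug ex0 ex1 /= e ej de.
have [e0 de0] := (ex1 0%N e).1 de.
have Xj i : 'X_[U_(i) *+ j] \in ideal_pow (max_ideal k n) j.
  by rewrite max_ideal_pow monoidealX wtMn wtU inE mul1n.
(* Since [x_i^j] kills [e = d e0], exactness puts [x_i^j e0] in the image of [S/J]; the lifts [f i]
   are the numerators to glue. Subtracting the glued element then makes [e0] torsion without
   changing its differential. *)
have lift i : exists f : S, aug (quotmap J f) = 'X_[U_(i) *+ j] *: e0.
  have /ex0[x <-] : d 0%N ('X_[U_(i) *+ j] *: e0) = 0.
    by rewrite linearZ /= de0; exact: ej.
  by have [f <-] := quotmap_surj x; exists f.
have [f augf] := choice lift.
have augqZ (p q : S) : aug (quotmap J (p *: (q : S^o))) = p *: aug (quotmap J q).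
  by rewrite linearZ /= linearZ.
have compat i i' : 'X_[U_(i') *+ j] * f i - 'X_[U_(i) *+ j] * f i' \in J.
  have : quotmap J ('X_[U_(i') *+ j] *: (f i : S^o)
                    - 'X_[U_(i) *+ j] *: (f i' : S^o)) == 0.
    apply/eqP/inj_aug; rewrite raddf0 raddfB /= raddfB /= !augqZ !augf.
    by rewrite !scalerA mulrC subrr.
  by rewrite quotmap_eq0.
pose g := glued D l j f.
exists (e0 - aug (quotmap J g)); split; last first.
  by rewrite raddfB /= de0 (ex0 _).2 ?subr0 //; exists (quotmap J g).
apply: (@torsion_of_powers _ _ (l + j)) => i.
rewrite scalerBr.
have eUlj : (U_(i) *+ (l + j) = U_(i) *+ l + U_(i) *+ j)%MM.
  by apply/mnmP => x; rewrite mnmDE !mulmnE mulnDr.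
rewrite {1}eUlj mpolyXD -scalerA -augf -!augqZ -raddfB /= -raddfB.
apply/eqP; rewrite -(raddf0 aug); apply/eqP; congr (aug _); apply/eqP.
rewrite quotmap_eq0.
exact: (gluedP hD hdim hl linked compat i).
Qed.
End Vanishing.

(** * Nonzero classes from disconnected degree complexes *)

Section Truncation.
Variables (k : fieldType) (n : nat) (Q : 'X_{1..n} -> bool).
Local Notation S := {mpoly k[n]}.
Implicit Types (f g p q : S).

Definition trunc p : S := \sum_(m <- msupp p | Q m) p@_m *: 'X_[m].

Lemma mcoeff_trunc p m : (trunc p)@_m = if Q m then p@_m else 0.
Proof.
rewrite /trunc raddf_sum /= [p in RHS]mpolyE raddf_sum /= big_mkcond /=.
rewrite (eq_bigr (fun m' => if Q m then (p@_m' *: 'X_[m'])@_m else 0)).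
  by case: ifP => // _; rewrite big1.
move=> m' _; rewrite mcoeffZ mcoeffX.
by have [->|_] := eqVneq m' m; rewrite ?mulr0 ?if_same.
Qed.

Lemma trunc_linear : linear trunc.
Proof.
move=> c p q; apply/mpolyP => m; rewrite mcoeffD mcoeffZ !mcoeff_trunc.
by case: ifP; rewrite ?mcoeffD ?mcoeffZ // mulr0 addr0.
Qed.

HB.instance Definition _ := GRing.isLinear.Build k S S _ trunc trunc_linear.

Lemma trunc_id p : p \in monoideal Q -> trunc p = p.
Proof.
move=> Qp; apply/mpolyP => m; rewrite mcoeff_trunc; case: ifP => // /negbT nQ.
by rewrite (monoideal_coeff Qp nQ).
Qed.

Lemma trunc_monoideal p : trunc p \in monoideal Q.
Proof. by apply/monoidealP => m; rewrite mcoeff_trunc; case: ifP; rewrite ?eqxx. Qed.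

End Truncation.

Section Nonvanishing.
Variables (k : fieldType) (n : nat) (D : {set {set 'I_n}}) (l : nat).
Hypothesis hD : simplicial_complex D.
Hypothesis hl : (0 < l)%N.
Local Notation S := {mpoly k[n]}.
Local Notation J := (symbolic_power (stanley_reisner k D) l).
Implicit Types (F G : {set 'I_n}) (p q : S).

Variables (a : 'X_{1..n}) (V : {set 'I_n}).
Hypothesis split_V : forall F, F \in facets D -> (wt F a < l)%N ->
  F \subset V \/ F \subset ~: V.

Local Notation QV := (fun m => l <= wt (~: V) m)%N.

(* The section of S/J over the punctured spectrum that is x^a on the charts
   x_i <> 0 with i in V and 0 on the others. *)
Definition partial_shift p : S := 'X_[a] * trunc QV p.

(** In degree at least [2 l], a monomial has degree at least [l] in the variables of [V] or in the
    others. The part [q1] with large [V]-degree commutes with truncation, so only [q2], of large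
    degree off [V], contributes an error. *)
Lemma partial_shift_mul p q : q \in ideal_pow (max_ideal k n) (2 * l) ->
  partial_shift (q * p) - p * partial_shift q \in J.
Proof.
rewrite max_ideal_pow => q2l.
have upV := @wt_upclosed n (~: V) l.
pose q1 := trunc QV q; pose q2 := q - q1.
have q2V : q2 \in wtideal V l.
  apply/monoidealP => m; rewrite /q2 mcoeffB mcoeff_trunc.
  case: ifP => [_|/negbT]; first by rewrite subrr eqxx.
  rewrite -ltnNge subr0 => mV qm; have /monoidealP/(_ m qm) := q2l.
  by rewrite wt_mdeg -(wt_compl V); lia.
have -> : partial_shift (q * p) - p * partial_shift q = 'X_[a] * trunc QV (q2 * p).
  rewrite /partial_shift mulrCA -mulrBr; congr (_ * _).
  rewrite -[q in q * p](subrK q1) -/q2 mulrDl raddfD /=.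
  rewrite [trunc QV (q1 * p)]trunc_id ?[p * _]mulrC ?addrK //.
  by rewrite mulrC; apply: monoidealMl => //; exact: trunc_monoideal.
rewrite symbolic_powerE //.
(* The error has degree at least [l] both in [V] and off [V]; a facet of low weight at [a] lies on
   one side, so it sees all the variables of the other. *)
apply: (@monoideal_prod _ _ (pred1 a) (fun m => (l <= wt V m) && (l <= wt (~: V) m))%N).
- move=> _ m /eqP -> /andP[mV mV']; apply/forall_inP => F FD; rewrite wtD.
  have [wF|/leq_trans -> //] := ltnP (wt F a) l; last exact: leq_addr.
  have [FV|FV] := split_V FD wF; have := wt_subset m FV; lia.
- by rewrite monoidealX /=.
- apply/monoidealP => m; rewrite mcoeff_trunc /=; case: ifP; rewrite ?eqxx // => mV nz.
  rewrite andbT; move: m nz {mV}; apply/monoidealP.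
  by rewrite mulrC; apply: monoidealMl => //; exact: wt_upclosed.
Qed.

(** The differential of [e0] is a torsion cocycle. Were it the differential of a torsion element,
    [e0] would agree on a power of the maximal ideal with multiplication by some [f], whose
    coefficient at [a] would be both 1 and 0. *)
Lemma disconnected_nonvanishing F0 G0 i j :
  F0 \in facets D -> G0 \in facets D -> (wt F0 a < l)%N -> (wt G0 a < l)%N ->
  i \in F0 -> j \in G0 -> i \in V -> j \notin V ->
  ~ local_cohomology_eq0 (max_ideal k n) 1 (quotmod J).
Proof.
move=> F0D G0D wF0 wG0 iF0 jG0 iV jV H1.
pose phi : {rmorphism k -> S} := @mpolyC n k.
have lin_e0 : klinear phi ((fun p => quotmap J (partial_shift p)) : S^o -> _).
  move=> c p q.
  have -> : partial_shift (phi c *: p + q) =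
            phi c *: (partial_shift p : S^o) + partial_shift q.
    rewrite /partial_shift -[phi c *: p]/(phi c * p) /= mul_mpolyC linearP /= mulrDr.
    by rewrite -[phi c *: _]/(phi c * _) /= mul_mpolyC scalerAr.
  by rewrite linearP.
pose e0 := mk_coinduced lin_e0.
pose E := coind_resolution phi (quotmod J).
have d_eq0 (e : coinduced phi (quotmod J)) :
    ires_diff E 0 e = 0 <-> exists v, coind_embed phi (quotmod J) v = e.
  exact: (@coind_diff_eq0 k S phi (quotmod J) 0 e).
have shift_e0 q : q \in ideal_pow (max_ideal k n) (2 * l) ->
    q *: e0 = coind_embed phi (quotmod J) (quotmap J (partial_shift q)).
  move=> q2l; apply: coinduced_ext => p /=.
  rewrite -linearZ /=; apply/eqP; rewrite quotmap_eq.
  exact: partial_shift_mul.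
have dd0 : ires_diff E 1 (ires_diff E 0 e0) = 0.
  by apply/(coind_diffP (ires_diff E 0 e0)); exists e0.
have tors : torsion (max_ideal k n) (ires_diff E 0 e0).
  exists (2 * l)%N => q q2l; rewrite -linearZ /= shift_e0 //.
  by apply/d_eq0; exists (quotmap J (partial_shift q)).
have [e' [[N e'N] de']] := H1 E _ tors dd0.
have : ires_diff E 0 (e0 - e') = 0.
  by rewrite raddfB; apply/eqP; rewrite subr_eq0; apply/eqP/esym.
move=> /d_eq0[x ex].
have [f fx] := quotmap_surj x.
(* The torsion part disappears on such [q], because [e' q] is [q *: e'] evaluated at 1. *)
have key q : q \in ideal_pow (max_ideal k n) N -> partial_shift q - q * f \in J.
  move=> qN; suff : quotmap J (partial_shift q) == quotmap J (q * f).
    by rewrite quotmap_eq.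
  have -> : quotmap J (q * f) = q *: quotmap J f by rewrite -linearZ.
  have -> : q *: quotmap J f = coind_fun (coind_embed phi _ x) q by rewrite fx.
  have -> : coind_fun (coind_embed phi _ x) q = coind_fun e0 q - coind_fun e' q.
    by rewrite ex.
  have /(congr1 (fun h => coind_fun h 1)) := e'N q qN.
  rewrite coind_scaleE mulr1 /= => e'q.
  by rewrite e'q subr0.
(* In the exponent [N + l], [N] makes [key] applicable and [l] lets a power of [x0] in [V] survive
   truncation. As [x0] is in [F], the weight at [F] stays low and the coefficient is determined
   modulo [J]. *)
have coef x0 F : F \in facets D -> (wt F a < l)%N -> x0 \in F ->
    f@_a = (x0 \in V)%:R.
  move=> FD wF xF; pose M := (N + l)%N.
  have wM : (wt F (U_(x0) *+ M + a)%MM < l)%N.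
    by rewrite wtD wtMn wtU xF mul0n add0n.
  have := key 'X_[U_(x0) *+ M]; rewrite max_ideal_pow monoidealX wtMn wtU inE mul1n.
  rewrite leq_addr => /(_ isT) /(coeff_mod_symb hD FD wM).
  rewrite [in RHS]mulrC mcoeffMX => <-.
  rewrite /partial_shift mulrC addmC mcoeffMX mcoeff_trunc mcoeffX eqxx.
  rewrite wtMn wtU inE negbK; case: (x0 \in V); first by rewrite mul1n leq_addl.
  by rewrite mul0n leqNgt hl.
have := coef i F0 F0D wF0 iF0; rewrite (coef j G0 G0D wG0 jG0) iV (negPf jV).
by move/eqP; rewrite eq_sym oner_eq0.
Qed.

End Nonvanishing.

(** * Redistribution of exponents on two disjoint facets *)

Section Rebalancing.
Variables (n l : nat).
Hypothesis hl : (2 <= l)%N.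
Implicit Types (m a c : 'X_{1..n}) (F G W : {set 'I_n}).

Definition mrestrict W a : 'X_{1..n} :=
  [multinom if i \in W then a i else 0%N | i < n].

Lemma wt_mrestrict F W a : wt F (mrestrict W a) = wt (F :|: ~: W) a.
Proof.
rewrite /wt [LHS]big_mkcond [RHS]big_mkcond; apply: eq_bigr => i _ /=.
by rewrite mnmE !inE negb_or negbK; case: (i \in F); case: (i \in W).
Qed.

Lemma submultinom_mdeg r m : (r <= mdeg m)%N ->
  exists2 c, (c <= m)%MM & mdeg c = r.
Proof.
rewrite -wt_mdeg => /wt_factor[g [_ gm]]; exists (\sum_(j < r) U_(g j))%MM => //.
rewrite mdeg_sum; under eq_bigr do rewrite mdeg1.
by rewrite sum_nat_const card_ord muln1.
Qed.

Lemma leq_wt_mnm F m m' : (m <= m')%MM -> (wt F m <= wt F m')%N.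
Proof. by move=> /mnm_lepP le; apply: leq_sum. Qed.

(* Writing l - 1 = q s + r with s = a(F0), multiply the part of a living on
   F0 and G0 by q and keep only a part of degree r of the rest: facets of the
   new degree complex that miss both F0 and G0 would then have weight at most
   r < s. *)
Lemma rebalance F0 G0 a : F0 :&: G0 = set0 -> (l <= mdeg a)%N ->
  wt F0 a = (l - 1)%N -> wt G0 a = (l - 1)%N ->
  exists b, [/\ wt F0 b = (l - 1)%N, wt G0 b = (l - 1)%N &
    forall F, (wt F b < l)%N ->
      (wt F a < l)%N /\ (F :&: F0 != set0 \/ F :&: G0 != set0)].
Proof.
move=> FG0 la wF0 wG0; pose W := F0 :|: G0; pose w := mrestrict W a.
pose o := mrestrict (~: W) a; pose s := wt (~: F0) a.
have sE : (s + (l - 1) = mdeg a)%N by rewrite -(wt_compl F0) wF0 addnC.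
have disj i : i \in F0 -> i \in G0 -> False.
  by move=> iF iG; have := in_set0 i; rewrite -FG0 inE iF iG.
have wa F : (wt F a = wt F w + wt F o)%N.
  rewrite -wtD; congr (wt F _); apply/mnmP => i; rewrite mnmDE !mnmE in_setC.
   by case: (i \in W); rewrite ?addn0.
have wF0w : wt F0 w = s.
  have e : wt (~: G0) a = s by have := wt_compl G0 a; lia.
  rewrite -e /w wt_mrestrict; congr (wt _ a); apply/setP => x; rewrite !inE.
  by have := @disj x; case: (x \in F0); case: (x \in G0) => // /(_ isT isT).
have wG0w : wt G0 w = s.
  rewrite /w wt_mrestrict; congr (wt _ a); apply/setP => x; rewrite !inE.
  by have := @disj x; case: (x \in F0); case: (x \in G0) => // /(_ isT isT).
have dw : mdeg w = (2 * s)%N.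
  have := wt_compl F0 w; rewrite wF0w => <-.
  suff -> : wt (~: F0) w = s by rewrite mul2n addnn.
  rewrite /w wt_mrestrict; congr (wt _ a); apply/setP => i; rewrite !inE.
  by case: (i \in F0).
have s0 : (0 < s)%N by lia.
have oE : (s + mdeg o = l - 1)%N.
  by have := wa set0; rewrite !wt_mdeg dw; lia.
pose q := ((l - 1) %/ s)%N; pose r := ((l - 1) %% s)%N.
have lqr : (l - 1 = q * s + r)%N by exact: divn_eq.
have rs : (r < s)%N by rewrite ltn_mod.
have q0 : (0 < q)%N by rewrite divn_gt0 //; lia.
(* The rest [o] is large enough: its degree is [l - 1 - s = (q - 1) s + r]. *)
have [|c co dc] := @submultinom_mdeg r o; first by nia.
have wc0 F : (forall i, i \in F -> i \in W) -> wt F c = r.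
  move=> FW; rewrite -dc -wt_mdeg /wt [LHS]big_mkcond; apply: eq_big => [i|i _].
    by rewrite inE.
  case: ifP => // /negbFE /FW iW; have /mnm_lepP/(_ i) := co.
  by rewrite mnmE inE iW leqn0 => /eqP.
exists (w *+ q + c)%MM; split=> [||F].
- by rewrite wtD wtMn wF0w wc0 ?lqr 1?mulnC // => i; rewrite inE => ->.
- by rewrite wtD wtMn wG0w wc0 ?lqr 1?mulnC // => i; rewrite inE orbC => ->.
rewrite wtD wtMn => wF.
(* With degrees taken on [F], low weight at the new monomial reads [q s <= q w(F) + c(F)]. Since
   [c(F) <= o(F)] and [q >= 1], it follows that [s <= w(F) + o(F)], which is low weight at [a]. If
   [F] misses both [F0] and [G0], then [w(F) = 0], contradicting [c(F) <= r < s]. *)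
have cF := wt_compl F c; have wFc := wt_compl F w; have oF := wt_compl F o.
have := leq_wt_mnm (~: F) co; rewrite dc in cF; rewrite dw in wFc => coF.
split; first by rewrite wa; nia.
apply: contrapT => /not_orP[/negP/negPn/eqP FF0 /negP/negPn/eqP FG].
have : wt (~: F) w = 0%N; last by nia.
rewrite /w wt_mrestrict /wt big1 // => i; rewrite !inE negb_or !negbK => /andP[iF].
case/orP=> iX; [have := in_set0 i; rewrite -FF0|have := in_set0 i; rewrite -FG];
  by rewrite inE iF iX.
Qed.

End Rebalancing.

(** * Linked facets from vanishing cohomology *)

Section Necessity.
Variables (k : fieldType) (n : nat) (D : {set {set 'I_n}}) (l : nat).
Hypotheses (hD : simplicial_complex D) (hdim : 1 <= sdim D) (hl : (2 <= l)%N).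
Local Notation J := (symbolic_power (stanley_reisner k D) l).

Lemma vanishing_facets_linked :
  local_cohomology_eq0 (max_ideal k n) 1 (quotmod J) -> facets_linked D l.
Proof.
move=> H1 F0 G0 a F0D G0D FG0 la wF0 wG0; apply: contrapT => nolink.
have [b [bF0 bG0 bP]] := rebalance hl FG0 la wF0 wG0.
(* [V] is the union of the low-weight facets at [b] that meet [F0]. Low weight at [b] implies low
   weight at [a], so the missing link at [a] keeps those meeting [G0] off [V]. *)
pose V := [set i | [exists F, [&& F \in facets D, (wt F b < l)%N,
                                  F :&: F0 != set0 & i \in F]]].
have nlink F G : F \in facets D -> G \in facets D -> (wt F b < l)%N ->
    (wt G b < l)%N -> F :&: F0 != set0 -> G :&: G0 != set0 -> F :&: G = set0.
  move=> FD GD /bP[wF _] /bP[wG _] FF0 GG0; apply/eqP/negPn/negP => FG.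
  by apply: nolink; exists F, G.
have bl : (l - 1 < l)%N by lia.
have [i iF0] := set0Pn _ (facet_neq0 hdim F0D).
have [j jG0] := set0Pn _ (facet_neq0 hdim G0D).
have meets G : G \in facets D -> (wt G b < l)%N -> G :&: G0 != set0 ->
    G \subset ~: V.
  move=> GD wG GG0; apply/subsetP => x xG; rewrite !inE.
  apply/negP => /existsP[F /and4P[FD wF FF0 xF]].
  by have := in_set0 x; rewrite -(nlink F G) // inE xF xG.
apply: (@disconnected_nonvanishing k n D l hD _ b V _ F0 G0 i j) H1 => //.
- by lia.
- move=> F FD wF; have [_ [FF0|FG]] := bP F wF; last by right; exact: meets.
  left; apply/subsetP => x xF; rewrite inE; apply/existsP; exists F.
  by rewrite FD wF FF0.
- by rewrite bF0.
- by rewrite bG0.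
- rewrite inE; apply/existsP; exists F0; rewrite F0D bF0 bl iF0 andbT /=.
  by apply/set0Pn; exists i; rewrite inE iF0.
- have : j \in ~: V; last by rewrite inE.
  apply: (subsetP (meets G0 G0D _ _)) => //; first by rewrite bG0.
  by apply/set0Pn; exists j; rewrite inE jG0.
Qed.

End Necessity.

Theorem theorem4p13 (k : fieldType) (n : nat) (D : {set {set 'I_n}}) (l : nat)
    (hD : simplicial_complex D) (hdim : 1 <= sdim D) (hl : (2 <= l)%N) :
  local_cohomology_eq0 (max_ideal k n) 1
    (quotmod (symbolic_power (stanley_reisner k D) l))
  <->
  forall (F0 G0 : {set 'I_n}) (a : 'X_{1..n}),
    F0 \in facets D -> G0 \in facets D -> F0 :&: G0 = set0 ->
    (l <= \sum_(i < n) a i)%N ->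
    (\sum_(i < n | i \notin F0) a i = l - 1)%N ->
    (\sum_(i < n | i \notin G0) a i = l - 1)%N ->
    let Da := degree_complex (symbolic_power (stanley_reisner k D) l) a in
    exists F G : {set 'I_n},
      [/\ F \in facets Da, G \in facets Da, F :&: F0 != set0,
          G :&: G0 != set0 & F :&: G != set0].
Proof.
split=> [/(vanishing_facets_linked hD hdim hl) linked F0 G0 a F0D G0D FG0|linked].
  rewrite -mdegE => la wF0 wG0 /=.
  have [F [G [FD GD wF wG [FF0 GG0 FG]]]] := linked F0 G0 a F0D G0D FG0 la wF0 wG0.
  by exists F, G; rewrite !degree_complex_facets // FD GD wF wG.
apply: facets_linked_vanishing => // F0 G0 a F0D G0D FG0; rewrite mdegE => la wF0 wG0.
have [F [G []]] := linked F0 G0 a F0D G0D FG0 la wF0 wG0.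
rewrite !degree_complex_facets // => /andP[FD wF] /andP[GD wG] FF0 GG0 FG.
by exists F, G.
Qed.
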